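(* Let $n$ be a positive integer, let $J\in\mathbb{R}^{n\times n}$ be a symmetric positive definite matrix and let $M\in\mathbb{R}^{n\times n}$ be a skew-symmetric matrix. Then the function $F:\mathbb{R}^{n\times n}\to\mathbb{R}$ given by $$F(X)=\left\|XJ-JX^T-M\right\|_F^2=2\,\mathrm{trace}\left(JX^TXJ\right)-2\,\mathrm{trace}(XJXJ)+4\,\mathrm{trace}(MXJ)-\mathrm{trace}(M^2)$$ is convex in $\mathbb{R}^{n\times n}$, that is, $$F\left(tX_1+(1-t)X_2\right)\leq tF(X_1)+(1-t)F(X_2)$$ for all $t\in[0,1]$ and all $X_1,X_2\in\mathbb{R}^{n\times n}$.
   Context: $\mathbb{R}^{n\times n}$ denotes the set of all $n\times n$ matrices with real entries, and $\|\cdot\|_F$ is the Frobenius norm, $\|A\|_F:=\sqrt{\mathrm{trace}(A^TA)}$. The two expressions given for $F(X)$ coincide for every $X\in\mathbb{R}^{n\times n}$ because $J^T=J$ and $M^T=-M$. *)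

(* Defs.v *)
From mathcomp Require Import all_boot all_order all_algebra.
From mathcomp Require Import reals.

Set Implicit Arguments.
Unset Strict Implicit.
Unset Printing Implicit Defensive.

Import Order.TTheory GRing.Theory Num.Theory.
Local Open Scope ring_scope.

Definition frobenius_norm (R : realType) (m n : nat) (A : 'M[R]_(m, n)) : R :=
  Num.sqrt (\tr (A^T *m A)).

Definition posdefmx (R : realType) (n : nat) (A : 'M[R]_n) : Prop :=
  A \is symmetricmx /\
  forall v : 'cV[R]_n, v != 0 -> 0 < (v^T *m A *m v) 0 0.

(* Main.v *)
Require Import Defs.
From mathcomp Require Import all_boot all_order all_algebra.
From mathcomp Require Import reals.
From mathcomp Require Import ring.

Set Implicit Arguments.
Unset Strict Implicit.
Unset Printing Implicit Defensive.

Import Order.TTheory GRing.Theory Num.Theory.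
Local Open Scope ring_scope.

(** The map sending [X] to [X *m J - J *m X^T - M] is affine, so it preserves convex combinations.
    The squared Frobenius norm is a sum of squares of entries, hence convex by [sqr_convex] applied
    entrywise, and a convex function of an affine map is convex. For the trace formula, put
    [Y = X *m J]: symmetry of [J] gives [J *m X^T = Y^T], and [frobenius_norm_sqr_skew] expands the
    norm of [Y - Y^T - M]. *)

Lemma mxtrace_trmul_sum (R : comPzRingType) (m n : nat) (A : 'M[R]_(m, n)) :
  \tr (A^T *m A) = \sum_i \sum_j A j i ^+ 2.
Proof.
rewrite /mxtrace; apply: eq_bigr => i _; rewrite mxE.
by apply: eq_bigr => j _; rewrite mxE expr2.
Qed.

Lemma frobenius_norm_sqr (R : realType) (m n : nat) (A : 'M[R]_(m, n)) :
  frobenius_norm A ^+ 2 = \tr (A^T *m A).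
Proof.
rewrite /frobenius_norm sqr_sqrtr // mxtrace_trmul_sum.
by do 2 (apply: sumr_ge0 => ? _); exact: sqr_ge0.
Qed.

(** The gap between the two sides is exactly [t * (1 - t) * (a - b) ^+ 2]. *)
Lemma sqr_convex (R : realFieldType) (t a b : R) : 0 <= t <= 1 ->
  (t * a + (1 - t) * b) ^+ 2 <= t * a ^+ 2 + (1 - t) * b ^+ 2.
Proof.
move=> /andP[t0 t1]; rewrite -subr_ge0.
have -> : t * a ^+ 2 + (1 - t) * b ^+ 2 - (t * a + (1 - t) * b) ^+ 2 =
  t * (1 - t) * (a - b) ^+ 2 by ring.
by rewrite mulr_ge0 ?sqr_ge0 ?mulr_ge0 ?subr_ge0.
Qed.

Lemma frobenius_norm_sqr_convex (R : realType) (m n : nat) (t : R)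
    (A B : 'M[R]_(m, n)) : 0 <= t <= 1 ->
  frobenius_norm (t *: A + (1 - t) *: B) ^+ 2 <=
  t * frobenius_norm A ^+ 2 + (1 - t) * frobenius_norm B ^+ 2.
Proof.
move=> ht; rewrite !frobenius_norm_sqr !mxtrace_trmul_sum.
rewrite !mulr_sumr -big_split; apply: ler_sum => i _.
rewrite !mulr_sumr -big_split; apply: ler_sum => j _.
by rewrite !mxE; exact: sqr_convex.
Qed.

(** Since [M] is skew, the transpose of [Y - Y^T - M] is its opposite up to the order of terms,
    [Y^T - Y + M]. The nine traces of the product merge by invariance under transposition and cyclic
    permutation; the four mixing [M] and [Y] all equal [\tr (M *m Y)], signs included. *)
Lemma frobenius_norm_sqr_skew (R : realType) (n : nat) (Y M : 'M[R]_n) :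
  M^T = - M ->
  frobenius_norm (Y - Y^T - M) ^+ 2 =
  2 * \tr (Y^T *m Y) - 2 * \tr (Y *m Y) + 4 * \tr (M *m Y) - \tr (M *m M).
Proof.
move=> hM; rewrite frobenius_norm_sqr !linearB /= trmxK hM opprK.
rewrite !(mulmxDl, mulmxDr, mulmxN, mulNmx) !(mxtraceD, raddfN) /=.
have -> : \tr (Y^T *m Y^T) = \tr (Y *m Y) by rewrite -trmx_mul mxtrace_tr.
have hMY : \tr (M *m Y^T) = - \tr (M *m Y).
  by rewrite -mxtrace_tr trmx_mul trmxK hM mulmxN raddfN /= mxtrace_mulC.
rewrite (mxtrace_mulC Y^T M) (mxtrace_mulC Y Y^T) (mxtrace_mulC Y M) hMY.
ring.
Qed.

Theorem lemma3 (R : realType) (n : nat) (hn : (0 < n)%N)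
    (J M : 'M[R]_n) (hJ : posdefmx J) (hM : M \is skewmx) :
  let F : 'M[R]_n -> R :=
    fun X => frobenius_norm (X *m J - J *m X^T - M) ^+ 2 in
  (forall X : 'M[R]_n,
     F X = 2 * \tr (J *m X^T *m X *m J) - 2 * \tr (X *m J *m X *m J)
           + 4 * \tr (M *m X *m J) - \tr (M *m M)) /\
  (forall (t : R) (X1 X2 : 'M[R]_n), 0 <= t <= 1 ->
     F (t *: X1 + (1 - t) *: X2) <= t * F X1 + (1 - t) * F X2).
Proof.
move=> F; split=> [X | t X1 X2 ht]; rewrite /F.
  have JT : J^T = J.
    (* [symmetricmx] is the hermitian condition with sign 1 and the identity as conjugation;
       [skewmx] below has sign -1. *)
    by case: hJ => /is_hermitianmxP hJ _; rewrite {2}hJ scale1r map_mx_id.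
  have MT : M^T = - M.
    move/is_hermitianmxP: hM => hM.
    by rewrite {2}hM expr1 scaleN1r opprK map_mx_id.
  have -> : J *m X^T = (X *m J)^T by rewrite trmx_mul JT.
  by rewrite frobenius_norm_sqr_skew // !mulmxA.
(* The constant term [M] splits correctly because the weights [t] and [1 - t] sum to 1. *)
have -> : (t *: X1 + (1 - t) *: X2) *m J - J *m (t *: X1 + (1 - t) *: X2)^T - M =
    t *: (X1 *m J - J *m X1^T - M) + (1 - t) *: (X2 *m J - J *m X2^T - M).
  rewrite linearD !linearZ /= mulmxDl mulmxDr -!scalemxAl -!scalemxAr.
  by apply/matrixP => i j; rewrite !mxE; ring.
exact: frobenius_norm_sqr_convex.
Qed.
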